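(* Every finitely presented group admitting an epimorphism onto the Grigorchuk group $\mathfrak G$ is large.
   Context: Let $X=\{0,1\}$ and $X^*$ the set of finite binary words (the binary rooted tree). The Grigorchuk group $\mathfrak G$ is the group of automorphisms of $X^*$ generated by $a,b,c,d$ defined recursively by: $a(0w)=1w$, $a(1w)=0w$; $b(0w)=0\,a(w)$, $b(1w)=1\,c(w)$; $c(0w)=0\,a(w)$, $c(1w)=1\,d(w)$; $d(0w)=0w$, $d(1w)=1\,b(w)$ (each fixing the empty word). A group is large if it has a finite-index subgroup admitting an epimorphism onto a non-abelian free group. *)

(* Defs.v *)
From Stdlib Require List.
From mathcomp Require Import all_boot.
Set Implicit Arguments.
Unset Strict Implicit.
Unset Printing Implicit Defensive.

Record group := Group {
  gcar :> Type;
  gmul : gcar -> gcar -> gcar;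
  ginv : gcar -> gcar;
  gone : gcar;
  gmulA : forall x y z, gmul x (gmul y z) = gmul (gmul x y) z;
  gmul1 : forall x, gmul gone x = x;
  gmulV : forall x, gmul (ginv x) x = gone }.
Arguments gmul {g}.
Arguments ginv {g}.
Arguments gone {g}.

(* a letter (i, false) is the generator x_i, (i, true) is x_i^-1 *)
Definition letter (n : nat) : Type := ('I_n * bool)%type.
Definition lflip n (l : letter n) : letter n := (l.1, ~~ l.2).
Definition winv n (w : seq (letter n)) : seq (letter n) := rev (map (@lflip n) w).
Definition reduce n (w : seq (letter n)) : seq (letter n) :=
  foldr (fun x acc => match acc with
                      | y :: t => if y == lflip x then t else x :: acc
                      | [::] => [:: x] end) [::] w.
Definition reduced n (w : seq (letter n)) : bool := reduce w == w.
(* multiplication in F_n (elements = reduced words) *)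
Definition fmul n (u v : seq (letter n)) : seq (letter n) := reduce (u ++ v).

Inductive nclosure n (R : seq (seq (letter n))) : seq (letter n) -> Prop :=
| ncl_nil : nclosure R [::]
| ncl_conj r c : r \in R -> nclosure R (c ++ r ++ winv c)
| ncl_conjV r c : r \in R -> nclosure R (c ++ winv r ++ winv c)
| ncl_cat u v : nclosure R u -> nclosure R v -> nclosure R (u ++ v)
| ncl_free u v : nclosure R u -> reduce u = reduce v -> nclosure R v.

Definition geval (G : group) n (g : 'I_n -> G) (w : seq (letter n)) : G :=
  foldr (fun l acc => gmul (if l.2 then ginv (g l.1) else g l.1) acc) gone w.

Definition finitely_presented (G : group) : Prop :=
  exists n (g : 'I_n -> G) (R : seq (seq (letter n))),
    (forall x : G, exists w, geval g w = x) /\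
    (forall w, geval g w = gone <-> nclosure R w).

Definition subgroup (G : group) (H : G -> Prop) : Prop :=
  H gone /\ (forall x y, H x -> H y -> H (gmul x y)) /\ (forall x, H x -> H (ginv x)).

Definition finite_index (G : group) (H : G -> Prop) : Prop :=
  exists T : list G, forall x : G, exists2 t, List.In t T & H (gmul (ginv t) x).

Definition free_epi (G : group) (H : G -> Prop) n (f : G -> seq (letter n)) : Prop :=
  (forall x, H x -> reduced (f x)) /\
  (forall x y, H x -> H y -> f (gmul x y) = fmul (f x) (f y)) /\
  (forall w, reduced w -> exists2 x, H x & f x = w).

Definition large (G : group) : Prop :=
  exists H : G -> Prop, subgroup H /\ finite_index H /\
    exists n, 2 <= n /\ exists f : G -> seq (letter n), free_epi H f.

(* ---------- the Grigorchuk group (false = 0, true = 1) ---------- *)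
Inductive ggen := ga | gb | gc | gd.

Fixpoint gact (s : ggen) (w : seq bool) : seq bool :=
  match w with
  | [::] => [::]
  | x :: w' =>
    match s with
    | ga => (~~ x) :: w'
    | gb => if x then x :: gact gc w' else x :: gact ga w'
    | gc => if x then x :: gact gd w' else x :: gact ga w'
    | gd => if x then x :: gact gb w' else x :: w'
    end
  end.

Definition gword_act (u : seq ggen) : seq bool -> seq bool :=
  foldr (fun s f => fun w => gact s (f w)) id u.

(* membership in the Grigorchuk group (generators are involutions, so
   positive words suffice) *)
Definition in_grig (f : seq bool -> seq bool) : Prop :=
  exists u, forall w, f w = gword_act u w.

Definition grig_epi (G : group) (phi : G -> seq bool -> seq bool) : Prop :=
  (forall x, in_grig (phi x)) /\
  (forall x y w, phi (gmul x y) w = phi x (phi y w)) /\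
  (forall f, in_grig f -> exists x, forall w, phi x w = f w).

(* Main.v *)
(** Write Gamma = C2 * V4 = <a> * {1, b, c, d}.  The group Gamma acts on the tree
    with the sections of the Grigorchuk group, and by contraction a word that
    acts trivially has trivial sections in Gamma at every deep enough level.
    Apply this to the finitely many relators of G and to lifts of a, b, c, d:
    for some m, every element of G has well-defined sections in Gamma at level m,
    and the section at the vertex 1^m maps the stabilizer of that vertex onto
    Gamma.  As Gamma has a free subgroup of rank 2 and index 4, G is large.  Both
    steps are combined: words act on pairs (vertex, coset of the free subgroup),
    and a cocycle with values in the free group labels this action. *)
Require Import Defs.
From mathcomp Require Import all_boot zify.
From Stdlib Require Import ClassicalEpsilon.
Set Implicit Arguments.
Unset Strict Implicit.
Unset Printing Implicit Defensive.

(** * Free reduction of words *)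

Section FreeReduction.
Variable n : nat.
Implicit Types (l : letter n) (u v w : seq (letter n)).

Definition push l w :=
  if w is l' :: w' then if l' == lflip l then w' else l :: w else [:: l].

Lemma lflipK : involutive (@lflip n).
Proof. by case=> i e; rewrite /lflip /= negbK. Qed.

Lemma reduce_cons l w : reduce (l :: w) = push l (reduce w).
Proof. by []. Qed.

Lemma reduced_behead l w : reduced (l :: w) -> reduced w.
Proof.
rewrite /reduced reduce_cons => /eqP.
have size_reduce w' : size (reduce w') <= size w'.
  elim: w' => //= k w' IH.
  by case: (reduce w') IH => //= k' t IH; case: ifP => _ /=; lia.
have := size_reduce w; case: (reduce w) => [|k t] /= les.
  by case: w les.
case: ifP => _; last by case=> ->.
by move=> et; move: les; rewrite et /=; lia.
Qed.

Lemma pushK l w : reduced w -> push l (push (lflip l) w) = w.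
Proof.
case: w => [|k w] /=; first by rewrite eqxx.
move=> red_kw; rewrite lflipK; case: eqP => [ekl|_] /=; last by rewrite eqxx.
rewrite -ekl; have := eqP red_kw; rewrite reduce_cons.
by rewrite (eqP (reduced_behead red_kw)).
Qed.

Lemma reduce_reduced w : reduced (reduce w).
Proof.
elim: w => // l w IH; rewrite reduce_cons.
case: (reduce w) IH => [_|k t red_kt] /=; first exact: eqxx.
case: ifP => [_|ne]; first exact: reduced_behead red_kt.
by rewrite /reduced reduce_cons (eqP red_kt) /= ne.
Qed.

Lemma reduce_foldr u v : reduce (u ++ v) = foldr push (reduce v) u.
Proof. by elim: u => //= l u IH; rewrite -IH. Qed.

Lemma reduce_idem w : reduce (reduce w) = reduce w.
Proof. exact/eqP/reduce_reduced. Qed.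

(** By [pushK] each letter acts invertibly on reduced words, so a cancelling pair in [u] acts
    trivially. *)
Lemma foldr_push_reduce u w :
  reduced w -> foldr push w (reduce u) = foldr push w u.
Proof.
move=> red_w.
have red_f u' : reduced (foldr push w u').
  by rewrite -(eqP red_w) -reduce_foldr reduce_reduced.
elim: u => // l u IH; rewrite reduce_cons [RHS]/= -IH.
case: (reduce u) => //= k t; case: eqP => //= ->.
by rewrite pushK.
Qed.

Lemma reduce_cat u u' v v' :
  reduce u = reduce u' -> reduce v = reduce v' ->
  reduce (u ++ v) = reduce (u' ++ v').
Proof.
move=> eu ev; rewrite !reduce_foldr ev.
by rewrite -foldr_push_reduce ?reduce_reduced // eu foldr_push_reduce ?reduce_reduced.
Qed.

Lemma reduce_fmul u v : reduce (u ++ v) = fmul (reduce u) (reduce v).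
Proof. by rewrite /fmul; apply: reduce_cat; rewrite reduce_idem. Qed.

End FreeReduction.

(** * The labelled action on pairs (vertex, coset) *)

Definition gtop (x : ggen) (y : bool) : bool := if x is ga then ~~ y else y.

Definition gsec (x : ggen) (y : bool) : seq ggen :=
  match x, y with
  | ga, _ => [::]
  | gb, true => [:: gc]
  | gc, true => [:: gd]
  | gd, true => [:: gb]
  | gd, false => [::]
  | _, false => [:: ga]
  end.

Definition state : Type := (seq bool * (bool * bool))%type.

(* C2 * V4 has a free subgroup of rank 2 and index 4: in its action on the
   cosets, V4 is regular and [ga] swaps them in two pairs; the two edges so
   obtained carry the free generators. *)
Definition base (x : ggen) (s : bool * bool) : (bool * bool) * seq (letter 2) :=
  match x with
  | ga => ((~~ s.1, s.2), [:: (inord s.2, s.1)])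
  | gb => ((~~ s.1, s.2), [::])
  | gc => ((s.1, ~~ s.2), [::])
  | gd => ((~~ s.1, ~~ s.2), [::])
  end.

(** Sections of a generator have at most one letter, so descending along the vertex follows a single
    generator until it dies or reaches the coset. *)
Fixpoint leaf (x : ggen) (v : seq bool) (s : bool * bool) :=
  if v is y :: v' then
    if gsec x y is z :: _ then leaf z v' s else (s, [::])
  else base x s.

Definition act1 (x : ggen) (p : state) : state := (gact x p.1, (leaf x p.1 p.2).1).
Definition lab1 (x : ggen) (p : state) : seq (letter 2) := (leaf x p.1 p.2).2.

Definition act (u : seq ggen) (p : state) : state := foldr act1 p u.
Fixpoint lab (u : seq ggen) (p : state) : seq (letter 2) :=
  if u is x :: u' then lab1 x (act u' p) ++ lab u' p else [::].

Lemma act_cat u v p : act (u ++ v) p = act u (act v p).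
Proof. exact: foldr_cat. Qed.

Lemma lab_cat u v p : lab (u ++ v) p = lab u (act v p) ++ lab v p.
Proof. by elim: u => //= x u IH; rewrite IH catA act_cat. Qed.

Lemma gword_act_cat u v w : gword_act (u ++ v) w = gword_act u (gword_act v w).
Proof. by elim: u => //= x u ->. Qed.

Lemma act_fst u p : (act u p).1 = gword_act u p.1.
Proof. by elim: u => //= x u ->. Qed.

Lemma size_act u p : size (act u p).1 = size p.1.
Proof.
have size_gact x v : size (gact x v) = size v.
  by elim: v x => // y v IH [] //=; case: y => /=; rewrite ?IH.
by rewrite act_fst; elim: u => //= x u IH; rewrite size_gact.
Qed.

Fixpoint top (u : seq ggen) (y : bool) : bool :=
  if u is x :: u' then gtop x (top u' y) else y.
Fixpoint sec (u : seq ggen) (y : bool) : seq ggen :=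
  if u is x :: u' then gsec x (top u' y) ++ sec u' y else [::].

Lemma act1_cons x y v s :
  act1 x (y :: v, s) =
  (gtop x y :: (act (gsec x y) (v, s)).1, (act (gsec x y) (v, s)).2).
Proof. by case: x; case: y. Qed.

Lemma lab1_cons x y v s : lab1 x (y :: v, s) = lab (gsec x y) (v, s).
Proof. by case: x; case: y => //=; rewrite cats0. Qed.

Lemma act_cons u y v s :
  act u (y :: v, s) =
  (top u y :: (act (sec u y) (v, s)).1, (act (sec u y) (v, s)).2).
Proof.
by elim: u => //= x u ->; rewrite act1_cons act_cat -surjective_pairing.
Qed.

(** Self-similarity: with [act_cons], this turns a question at level m+1 into one about first-level
    sections at level m. *)
Lemma lab_cons u y v s : lab u (y :: v, s) = lab (sec u y) (v, s).
Proof.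
by elim: u => //= x u IH; rewrite act_cons lab1_cons IH lab_cat -surjective_pairing.
Qed.

(** * Equality of words at a level, and contraction *)

(** The coset action together with the reduced label determines an element of C2 * V4; so this says
    that both words permute level m alike and have equal sections in C2 * V4 there. *)
Definition eqlev (m : nat) (u u' : seq ggen) : Prop :=
  forall p, size p.1 = m -> act u p = act u' p /\ reduce (lab u p) = reduce (lab u' p).

Lemma eqlev_refl m u : eqlev m u u. Proof. by []. Qed.

Lemma eqlev_sym m u u' : eqlev m u u' -> eqlev m u' u.
Proof. by move=> e p /e[-> ->]. Qed.

Lemma eqlev_trans m u v w : eqlev m u v -> eqlev m v w -> eqlev m u w.
Proof. by move=> e e' p sp; have [-> ->] := e p sp; apply: e'. Qed.

Lemma eqlev_cat m u u' v v' :
  eqlev m u u' -> eqlev m v v' -> eqlev m (u ++ v) (u' ++ v').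
Proof.
move=> eu ev p sp; have [av lv] := ev p sp.
have [|au lu] := eu (act v p); first by rewrite size_act.
rewrite !act_cat !lab_cat -av au; split=> //.
exact: reduce_cat.
Qed.

Definition contract (x y : ggen) : seq ggen :=
  match x, y with
  | ga, ga | gb, gb | gc, gc | gd, gd => [::]
  | gb, gc | gc, gb => [:: gd]
  | gb, gd | gd, gb => [:: gc]
  | gc, gd | gd, gc => [:: gb]
  | _, _ => [:: x; y]
  end.

(** At level 0 these are the defining relations of C2 * V4, checked on the four cosets; deeper down,
    they reproduce themselves. *)
Lemma eqlev_contract m x y : eqlev m [:: x; y] (contract x y).
Proof.
elim: m x y => [|m IH] x y [v [s1 s2]].
  by case: v => // _; case: x; case: y; case: s1; case: s2;
    rewrite /act1 /lab1 /= /lflip /= ?eqxx.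
case: v => // t v [sv]; rewrite !act_cons !lab_cons.
suff [-> ->] : act (sec [:: x; y] t) (v, (s1, s2)) =
               act (sec (contract x y) t) (v, (s1, s2)) /\
    reduce (lab (sec [:: x; y] t) (v, (s1, s2))) =
    reduce (lab (sec (contract x y) t) (v, (s1, s2))).
  by split=> //; congr (_ :: _, _); case: x; case: y; case: t.
(* The two sections either coincide literally or form another instance of [contract]. *)
have [->//|[x' [y' [-> ->]]]] : sec [:: x; y] t = sec (contract x y) t \/
    exists x' y', sec [:: x; y] t = [:: x'; y'] /\
                  sec (contract x y) t = contract x' y'.
  by case: x; case: y; case: t; (left; reflexivity) ||
    (right; do 2 eexists; split; reflexivity).
exact: (IH x' y' (v, (s1, s2)) sv).
Qed.

Lemma eqlev_rev m u : eqlev m (rev u ++ u) [::].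
Proof.
elim: u => [|x u IH]; first exact: eqlev_refl.
rewrite rev_cons -cats1 -catA /=; apply: eqlev_trans IH.
apply: eqlev_cat; first exact: eqlev_refl.
rewrite -[x :: x :: u]/([:: x; x] ++ u) -[X in eqlev _ _ X]/([::] ++ u).
apply: eqlev_cat; last exact: eqlev_refl.
by have := eqlev_contract (m := m) x x; case: x.
Qed.

Definition is_a (x : ggen) := if x is ga then true else false.
Definition alt (x y : ggen) := is_a x != is_a y.

Lemma alternating_or_contractible u :
  sorted alt u \/ exists p x y q, u = p ++ [:: x; y] ++ q /\ ~~ alt x y.
Proof.
elim: u => [|x [|y u] IH]; [by left | by left |].
case axy: (alt x y); last by right; exists [::], x, y, u; rewrite axy.
case: IH => [IH|[p [x' [y' [q [-> IH]]]]]].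
  by left; rewrite /= axy.
by right; exists (x :: p), x', y', q.
Qed.

Lemma size_sec u y : size (sec u y) <= count (predC is_a) u.
Proof. by elim: u => //= x u IH; rewrite size_cat; case: x; case: (top u y) => /=; lia. Qed.

(** Only letters other than [ga] contribute to a section, at most one letter each, and they fill at
    most half of an alternating word, rounded up. *)
Lemma size_sec_alternating u y :
  sorted alt u -> 1 < size u -> size (sec u y) < size u.
Proof.
have path_count x w : path alt x w -> (count (predC is_a) w).*2 <= size w + is_a x.
  elim: w x => //= z w IH x /andP[axz /IH].
  by move: axz; rewrite /alt; case: (is_a x); case: (is_a z) => /=; lia.
case: u => // x u pu su; apply: leq_ltn_trans (size_sec _ _) _.
by move: su (path_count _ _ pu) => /=; case: (is_a x) => /=; lia.
Qed.

(* Contraction: the word problem of the Grigorchuk group is solved by passing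
   to shorter and shorter sections, until only relations of C2 * V4 are left. *)
Lemma trivial_eqlev u :
  (forall v, gword_act u v = v) -> exists n, forall m, n <= m -> eqlev m u [::].
Proof.
have [k] := ubnP (size u); elim: k => // k IH in u * => ltuk triv_u.
case: (alternating_or_contractible u) => [alt_u|[p [x [y [q [def_u nxy]]]]]].
  case: (ltnP 1 (size u)) => [gt1|].
    have triv_sec y : top u y = y /\ forall v, gword_act (sec u y) v = v.
      have e v : (act u (y :: v, (false, false))).1 = y :: v by rewrite act_fst triv_u.
      split=> [|v]; first by have := e [::]; rewrite act_cons => -[].
      by have := e v; rewrite act_cons act_fst => -[].
    have sub y : exists n, forall m, n <= m -> eqlev m (sec u y) [::].
      apply: IH (triv_sec y).2.
      by have := size_sec_alternating y alt_u gt1; lia.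
    have [n0 e0] := sub false; have [n1 e1] := sub true.
    (* The successor pays for the letter consumed in passing to sections. *)
    exists (maxn n0 n1).+1 => -[//|m]; rewrite ltnS geq_max => /andP[le0 le1].
    move=> [[|y v] s] //= [sv]; rewrite act_cons lab_cons (triv_sec y).1.
    suff [-> ->] : act (sec u y) (v, s) = (v, s) /\
        reduce (lab (sec u y) (v, s)) = [::] by [].
    by case: y; [apply: (e1 m le1 (v, s)) | apply: (e0 m le0 (v, s))].
  (* No single generator acts trivially: each is refuted by a vertex that it moves. *)
  case: u triv_u {ltuk alt_u} => [|x [|//]] triv_u _; first by exists 0.
  by case: x triv_u => triv_u;
    [have := triv_u [:: true] | have := triv_u [:: false; true]
    | have := triv_u [:: false; true] | have := triv_u [:: true; false; true]].
have e m : eqlev m u (p ++ contract x y ++ q).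
  rewrite def_u; apply: eqlev_cat; first exact: eqlev_refl.
  by apply: eqlev_cat; [apply: eqlev_contract | apply: eqlev_refl].
have [|v|n en] := IH (p ++ contract x y ++ q).
- move: ltuk; rewrite def_u !size_cat /=.
  by case: (x) nxy; case: (y) => //= _; lia.
- rewrite -[v]/((v, (false, false)).1) -act_fst.
  by have [<- _] := e _ (v, (false, false)) erefl; rewrite act_fst triv_u.
by exists n => m /en; apply: eqlev_trans (e m).
Qed.

(** * Lifting C2 * V4 and its free subgroup to the vertex 1^m *)

(** A substitution of Lysenok type, chosen as a right inverse of the section at [true]. *)
Definition subst1 (x : ggen) : seq ggen :=
  match x with ga => [:: ga; gb; ga] | gb => [:: gd] | gc => [:: gb] | gd => [:: gc] end.
Definition subst (u : seq ggen) : seq ggen := flatten (map subst1 u).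

Lemma subst_sec u : top (subst u) true = true /\ sec (subst u) true = u.
Proof.
have top_cat v w y : top (v ++ w) y = top v (top w y).
  by elim: v => //= x v ->.
have sec_cat v w y : sec (v ++ w) y = sec v (top w y) ++ sec w y.
  by elim: v => //= x v ->; rewrite top_cat catA.
elim: u => // x u [IHt IHs].
rewrite /subst /= -/(subst u) top_cat sec_cat IHt IHs.
by case: x.
Qed.

Definition origin (m : nat) : state := (nseq m true, (false, false)).

(** Read from the right: V4 moves the base coset to an end of the edge labelled by [l], [ga] crosses
    the edge, and V4 leads back. *)
Definition loop (l : letter 2) : seq ggen :=
  if l.1 == ord0 then if l.2 then [:: ga; gb] else [:: gb; ga]
  else if l.2 then [:: gc; ga; gd] else [:: gd; ga; gc].

Lemma act_lab_subst m u s :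
  let p := ([::], s) in
  act (iter m subst u) (nseq m true, s) = (nseq m true, (act u p).2) /\
  lab (iter m subst u) (nseq m true, s) = lab u p.
Proof.
elim: m u => [|m IH] u /=.
  by split=> //; rewrite [LHS]surjective_pairing act_fst; congr (_, _);
     elim: u => //= x u ->; case: x.
rewrite -/(iter m.+1 subst u) iterS act_cons lab_cons.
have [-> ->] := subst_sec (iter m subst u).
by have [-> ->] := IH u.
Qed.

Lemma loopP m l :
  act (iter m subst (loop l)) (origin m) = origin m /\
  lab (iter m subst (loop l)) (origin m) = [:: l].
Proof.
have [-> ->] := act_lab_subst m (loop l) (false, false).
have i0 : inord 0 = ord0 :> 'I_2 by apply: val_inj; rewrite /= inordK.
have i1 i : (i == ord0) = false -> inord 1 = i :> 'I_2.
  by case: i => -[|[|//]] //= lti _; apply: val_inj; rewrite /= inordK.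
case: l => i []; rewrite /loop /=; case: eqP => [->|/eqP/negbTE ne] /=;
  rewrite /act1 /lab1 /= ?i0 ?(i1 _ ne) //.
Qed.

Lemma loops_label m (w : seq (letter 2)) :
  exists u, act u (origin m) = origin m /\ lab u (origin m) = w.
Proof.
elim: w => [|l w [u [au lu]]]; first by exists [::].
have [al ll] := loopP m l.
by exists (iter m subst (loop l) ++ u); rewrite act_cat lab_cat au al ll lu.
Qed.

(** * Transfer to a finitely presented group *)

Section GroupFacts.
Variable G : group.
Implicit Types x y : G.

Lemma gmulVr x : gmul x (ginv x) = gone.
Proof.
rewrite -[LHS]gmul1 -(gmulV (ginv x)) -gmulA.
by rewrite [gmul (ginv x) _]gmulA gmulV gmul1.
Qed.

Lemma gmul1r x : gmul x gone = x.
Proof. by rewrite -(gmulV x) gmulA gmulVr gmul1. Qed.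

Variables (n : nat) (g : 'I_n -> G).

Lemma geval_cat u v : geval g (u ++ v) = gmul (geval g u) (geval g v).
Proof. by elim: u => [|l u IH] /=; rewrite ?gmul1 // IH gmulA. Qed.

Lemma geval_winv w : gmul (geval g w) (geval g (winv w)) = gone.
Proof.
elim: w => [|l w IH]; first exact: gmul1.
rewrite /winv /= rev_cons -cats1 geval_cat -/(winv w) /= gmul1r.
rewrite -gmulA [gmul (geval g w) _]gmulA IH gmul1.
by case: l => i [] /=; rewrite ?gmulV ?gmulVr.
Qed.

End GroupFacts.

Lemma gword_act_rev u v : gword_act u (gword_act (rev u) v) = v.
Proof.
have := (@eqlev_rev (size v) (rev u) (v, (false, false)) erefl).1.
rewrite revK act_cat => /(congr1 fst) /=.
by rewrite !act_fst.
Qed.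

Section FinitelyPresentedCover.
Variables (G : group) (phi : G -> seq bool -> seq bool).
Hypothesis phi_epi : grig_epi phi.
Variables (n : nat) (g : 'I_n -> G) (R : seq (seq (letter n))).
Hypothesis g_gen : forall x : G, exists w, geval g w = x.
Hypothesis g_rel : forall w, geval g w = gone <-> nclosure R w.

Let phiM x y w : phi (gmul x y) w = phi x (phi y w).
Proof. exact: phi_epi.2.1. Qed.

Let phi1 w : phi gone w = w.
Proof.
have [u eu] := phi_epi.1 gone.
have e v : phi gone (phi gone v) = phi gone v by rewrite -phiM gmul1.
(* The idempotent map [phi gone] is onto, being given by a word in involutions; hence it is the
   identity. *)
by have := e (gword_act (rev u) w); rewrite [phi gone (gword_act _ _)]eu gword_act_rev.
Qed.

Let gen_word i : {u | forall w, phi (g i) w = gword_act u w}.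
Proof. exact/constructive_indefinite_description/phi_epi.1. Qed.

Let lword (l : letter n) : seq ggen :=
  if l.2 then rev (sval (gen_word l.1)) else sval (gen_word l.1).
Let gword (w : seq (letter n)) : seq ggen := flatten (map lword w).

Let gword_cat u v : gword (u ++ v) = gword u ++ gword v.
Proof. by rewrite /gword map_cat flatten_cat. Qed.

Let lword_flip l : lword (lflip l) = rev (lword l).
Proof. by case: l => i []; rewrite /lword //= revK. Qed.

Let gword_winv w : gword (winv w) = rev (gword w).
Proof.
elim: w => // l w IH.
by rewrite /winv /= rev_cons -cats1 gword_cat -/(winv w) IH /gword /= cats0
  lword_flip rev_cat.
Qed.

Let phi_geval w v : phi (geval g w) v = gword_act (gword w) v.
Proof.
elim: w v => [|[i e] w IH] v /=; first exact: phi1.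
rewrite phiM IH /gword /= -/(gword w) gword_act_cat.
rewrite /lword /=; case: (gen_word i) => u /= eu; case: e => //.
set v' := gword_act (gword w) v.
by rewrite -{1}[v'](gword_act_rev u) -eu -phiM gmulV phi1.
Qed.

Let gword_gen x : exists w, forall v, gword_act (gword w) v = gact x v.
Proof.
have [|y ey] := phi_epi.2.2 (gact x); first by exists [:: x].
by have [w ew] := g_gen y; exists w => v; rewrite -phi_geval ew.
Qed.

(** The relators die, so G acts with labels at level m; and every generator of C2 * V4 is attained,
    so labels can be prescribed. *)
Let good_level m :=
  (forall r, r \in R -> eqlev m (gword r) [::]) /\
  forall x, exists w, eqlev m (gword w) [:: x].

Let exists_good_level : exists m, good_level m.
Proof.
have rels (R' : seq (seq (letter n))) : {subset R' <= R} ->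
    exists k, forall m, k <= m -> forall r, r \in R' -> eqlev m (gword r) [::].
  elim: R' => [|r R' IH] sR; first by exists 0.
  have [|k ek] := IH; first by move=> r' r'R; apply: sR; rewrite inE r'R orbT.
  have [v|k' ek'] := @trivial_eqlev (gword r).
    rewrite -phi_geval (_ : geval g r = gone) ?phi1 //; apply/g_rel.
    rewrite -[r]cats0; apply: (@ncl_conj _ R r [::]).
    by apply: sR; rewrite inE eqxx.
  exists (maxn k k') => m; rewrite geq_max => /andP[km k'm] r'.
  by rewrite inE => /orP[/eqP->|]; [apply: ek' | apply: ek].
have gens x : exists k, forall m, k <= m -> exists w, eqlev m (gword w) [:: x].
  have [w ew] := gword_gen x.
  (* As [x] is an involution, a lift of [x] followed by [x] acts trivially on the tree, so
     contraction applies. *)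
  have [v|k ek] := @trivial_eqlev (gword w ++ [:: x]).
    by rewrite gword_act_cat ew; exact: (gword_act_rev [:: x]).
  exists k => m /ek e; exists w; rewrite -[gword w]cats0.
  apply: eqlev_trans (_ : eqlev m _ ((gword w ++ [:: x]) ++ [:: x])) _.
    rewrite -catA; apply: eqlev_cat; first exact: eqlev_refl.
    exact/eqlev_sym/(@eqlev_rev m [:: x]).
  exact: (@eqlev_cat m _ [::]).
have [k ek] := rels R (fun _ => id).
have [ka ea] := gens ga; have [kb eb] := gens gb.
have [kc ec] := gens gc; have [kd ed] := gens gd.
exists (k + ka + kb + kc + kd); split; first by apply: ek; lia.
by case; [apply: ea | apply: eb | apply: ec | apply: ed]; lia.
Qed.

Section Level.
Variable m : nat.
Hypothesis m_good : good_level m.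

Let eqlev_reduce w : eqlev m (gword (reduce w)) (gword w).
Proof.
elim: w => // l w IH; rewrite reduce_cons.
apply: eqlev_trans (_ : eqlev m _ (gword (l :: reduce w))) _; last first.
  by rewrite /gword /=; apply: eqlev_cat.
case: (reduce w) => //= k t; case: eqP => // ->; rewrite /gword /= catA.
rewrite -[X in eqlev _ X]cat0s; apply: eqlev_cat; last exact: eqlev_refl.
rewrite lword_flip -{1}[lword l]revK; exact/eqlev_sym/eqlev_rev.
Qed.

Let eqlev_revr u : eqlev m (u ++ rev u) [::].
Proof. by rewrite -{1}[u]revK; apply: eqlev_rev. Qed.

Let eqlev_nclosure w : nclosure R w -> eqlev m (gword w) [::].
Proof.
have conj c u : eqlev m u [::] -> eqlev m (gword c ++ u ++ gword (winv c)) [::].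
  move=> eu; apply: eqlev_trans (eqlev_revr (gword c)); rewrite gword_winv.
  apply: eqlev_cat; first exact: eqlev_refl.
  exact: (@eqlev_cat m u [::]).
elim=> [|r c rR|r c rR|u v _ eu _ ev|u v _ eu euv] //.
- by rewrite !gword_cat; apply/conj/m_good.1.
- rewrite !gword_cat; apply: conj; rewrite gword_winv.
  apply: eqlev_trans (@eqlev_rev m (gword r)); rewrite -{1}[rev _]cats0.
  by apply: eqlev_cat => //; apply/eqlev_sym/m_good.1.
- by rewrite gword_cat; apply: (eqlev_cat eu).
apply: eqlev_trans (eqlev_sym (@eqlev_reduce v)) _; rewrite -euv.
exact: eqlev_trans (@eqlev_reduce u) eu.
Qed.

(** The labelled action at level m depends only on the element of G, because the relators generate
    all relations. *)
Let eqlev_geval w w' : geval g w = geval g w' -> eqlev m (gword w) (gword w').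
Proof.
move=> eww'; have : nclosure R (w ++ winv w').
  by apply/g_rel; rewrite geval_cat eww' geval_winv.
move/eqlev_nclosure; rewrite gword_cat gword_winv => e.
apply: eqlev_trans (_ : eqlev m _ ((gword w ++ rev (gword w')) ++ gword w')) _.
  rewrite -{1}[gword w]cats0 -catA; apply: eqlev_cat; first exact: eqlev_refl.
  exact/eqlev_sym/eqlev_rev.
exact: (@eqlev_cat m _ [::]).
Qed.

Let rep (x : G) : {w | geval g w = x}.
Proof. exact/constructive_indefinite_description/g_gen. Qed.

Let rword (x : G) : seq ggen := gword (sval (rep x)).

Let rword_geval w : eqlev m (rword (geval g w)) (gword w).
Proof. by apply: eqlev_geval; case: (rep _). Qed.

Let rwordM x y : eqlev m (rword (gmul x y)) (rword x ++ rword y).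
Proof.
rewrite -gword_cat; apply: eqlev_geval; rewrite geval_cat.
by case: (rep _) => w /= ->; case: (rep x) => w1 /= ->; case: (rep y) => w2 /= ->.
Qed.

Let rword1 : eqlev m (rword gone) [::].
Proof. exact: (rword_geval [::]). Qed.

Let rword_surj u : exists x, eqlev m (rword x) u.
Proof.
suff [w ew] : exists w, eqlev m (gword w) u.
  by exists (geval g w); apply: eqlev_trans (rword_geval w) ew.
elim: u => [|x u [w ew]]; first by exists [::].
have [w' ew'] := m_good.2 x.
by exists (w' ++ w); rewrite gword_cat; apply: (eqlev_cat ew' ew).
Qed.

Let o := origin m.
Let size_o : size o.1 = m. Proof. exact: size_nseq. Qed.
Let mv x := act (rword x) o.

Let mvM x y : mv (gmul x y) = act (rword x) (mv y).
Proof. by rewrite /mv (rwordM x y size_o).1 act_cat. Qed.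

Let mvV x y : mv x = mv y -> mv (gmul (ginv x) y) = o.
Proof. by move=> e; rewrite mvM -e -mvM gmulV /mv (rword1 size_o).1. Qed.

Let stab x := mv x = o.

Let stab_subgroup : subgroup stab.
Proof.
split; [exact: (rword1 size_o).1 | split=> [x y sx sy | x sx]].
  by rewrite /stab mvM sy.
have s1 : mv gone = o := (rword1 size_o).1.
by rewrite /stab -[ginv x]gmul1r mvV // s1.
Qed.

(** Cosets of [stab] correspond to points of the orbit of [o], which lies in the finite set of
    level-m vertices paired with four cosets. *)
Let stab_finite_index : finite_index stab.
Proof.
have cover (Q : seq (m.-tuple bool * (bool * bool))) : exists T : list G,
    forall x, (exists2 q, q \in Q & mv x = (val q.1, q.2)) ->
    exists2 t, List.In t T & mv t = mv x.
  elim: Q => [|q Q [T eT]]; first by exists nil => x [].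
  (* One representative is kept for each state that the orbit reaches. *)
  have [[t et]|not] := classic (exists t, mv t = (val q.1, q.2)).
    exists (t :: T) => x [q']; rewrite inE => /orP[/eqP-> ex|q'Q ex].
      by exists t; [left | rewrite et ex].
    by have [|t' inT ?] := eT x; [exists q' | exists t'; first right].
  exists T => x [q']; rewrite inE => /orP[/eqP-> ex|q'Q ex].
    by case: not; exists x.
  by apply: eT; exists q'.
have [T eT] := cover (enum {: m.-tuple bool * (bool * bool)}).
exists T => x; have [|t tT et] := eT x.
  have sx : size (mv x).1 == m by rewrite size_act size_o.
  exists (Tuple sx, (mv x).2); first by rewrite mem_enum.
  by rewrite /= -surjective_pairing.
by exists t => //; apply: mvV.
Qed.

(** A cocycle restricts to a homomorphism on the stabilizer of a point; [loops_label] makes it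
    onto. *)
Let stab_free_epi : free_epi stab (fun x => reduce (lab (rword x) o)).
Proof.
split=> [x _|]; first exact: reduce_reduced.
split=> [x y sx sy|w red_w].
  rewrite (rwordM x y size_o).2 lab_cat -/(mv y) sy; exact: reduce_fmul.
have [u [au lu]] := loops_label m w.
have [x ex] := rword_surj u.
exists x; first by rewrite /stab /mv (ex _ size_o).1.
by rewrite (ex _ size_o).2 lu; apply/eqP.
Qed.

Lemma large_of_good_level : large G.
Proof.
exists stab; split; first exact: stab_subgroup.
split; first exact: stab_finite_index.
by exists 2; split=> //; exists (fun x => reduce (lab (rword x) o)).
Qed.

End Level.

Lemma large_of_presentation : large G.
Proof. by have [m] := exists_good_level; apply: large_of_good_level. Qed.

End FinitelyPresentedCover.

Theorem theorem1p6 (G : group) (phi : G -> seq bool -> seq bool) :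
  finitely_presented G -> grig_epi phi -> large G.
Proof.
move=> [n [g [R [g_gen g_rel]]]] phi_epi.
exact (large_of_presentation phi_epi g_gen g_rel).
Qed.
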